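(* Let $D$ be an oriented virtual knot diagram, $G=G(D)$ its Gauss diagram, and $\iota_G=[vi_D]\in H^1(G,\mathbb Z)$ the virtual index class. There exists a unique cocycle $i^{ch}_G\in C^1(G,\mathbb Z)$ such that $[i^{ch}_G]=\iota_G$ and $i^{ch}_G$ vanishes on every edge of the core cycle $CC(G)$. Moreover, for any chord $c$ of $G$ we have $i^{ch}_G(c)=Ind_D(c)$.
   Context: An oriented virtual knot diagram $D$ is a generic immersion of one oriented circle into the oriented plane, each transversal double point being marked classical (with over/under information) or virtual. The Gauss diagram $G=G(D)$ is viewed as a graph: its core cycle $CC(G)$ is the parametrizing oriented circle, subdivided by the preimages of the classical crossings, and for every classical crossing $c$ there is a chord (also denoted $c$), an edge oriented from the overcrossing preimage of $c$ to the undercrossing preimage. Edges of $CC(G)$ correspond to long arcs of $D$ (arcs between consecutive classical crossings). $C^1(G,\mathbb Z)$ is the group of integer functions on oriented edges, and coboundaries are $(\delta g)(e)=g(\text{head})-g(\text{tail})$. The virtual index cocycle $vi_D\in C^1(G,\mathbb Z)$ is zero on chords, and on the core edge corresponding to a long arc $e$ it is the sum over all passages of $e$ (along its orientation) through virtual crossings of $+1$ if the other strand crosses from right to left and $-1$ if from left to right (a virtual self-crossing of $e$ is counted at both passages). At a classical crossing $c$ name the two strands $a,b$ so that (direction of $a$, direction of $b$) is a positive frame. $\operatorname{sign}(c)=+1$ if (over-strand, under-strand) is a positive frame, $-1$ otherwise. The left half $D^l_c$ is the closed path in $D$ leaving $c$ along the outgoing edge of $b$ and returning along the incoming edge of $a$;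 the right half $D^r_c$ is the complementary closed path. $D^+_c=D^l_c$ if $\operatorname{sign}(c)=+1$, $D^+_c=D^r_c$ if $\operatorname{sign}(c)=-1$. The index $Ind_D(c)$ is the sum over all passages of $D^+_c$ through classical crossings $c'\ne c$ of $+1$ if the other strand crosses from left to right and $-1$ if it crosses from right to left. *)

(* Defs.v *)
From mathcomp Require Import all_boot all_order all_algebra.
From mathcomp Require Import all_classical all_reals all_analysis.
Import Order.TTheory GRing.Theory Num.Theory.
Import numFieldNormedType.Exports.

Set Implicit Arguments.
Unset Strict Implicit.
Unset Printing Implicit Defensive.

Local Open Scope classical_set_scope.
Local Open Scope ring_scope.

Record digraph := Digraph {
  vertex : finType;
  edge : finType;
  tail : edge -> vertex;
  head : edge -> vertex }.

(* A graph has no 2-cells, so that every 1-cochain is a cocycle: this type is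
   both the group of 1-cochains and the group of 1-cocycles. *)
Definition cochain1 (G : digraph) : Type := {ffun edge G -> int}.

Definition coboundary (G : digraph) (g : {ffun vertex G -> int}) :
    cochain1 G := [ffun e => g (head e) - g (tail e)].

(* The elements of H^1(G, Z) are the cosets of the group of coboundaries. *)
Definition cohomology_class (G : digraph) (f : cochain1 G) :
    set (cochain1 G) :=
  [set h | exists g : {ffun vertex G -> int}, h = f + coboundary g].

Section PlaneCurves.
Variable R : realType.

Definition frame_det (u v : R * R) : R := u.1 * v.2 - u.2 * v.1.

Definition velocity (x y : R -> R) (t : R) : R * R := (derive1 x t, derive1 y t).

(* The oriented circle is R/Z, so that a closed curve is 1-periodic; the points
   of the circle are represented by the parameters in [0, 1[.  Immersions are
   only assumed to be of class C^1, which includes the smooth ones. *)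
Record closed_immersion (x y : R -> R) : Prop := ClosedImmersion {
  ci_periodic : forall t, x (t + 1) = x t /\ y (t + 1) = y t;
  ci_derivable : forall t : R, derivable x t 1 /\ derivable y t 1;
  ci_continuous : continuous (derive1 x) /\ continuous (derive1 y);
  ci_regular : forall t, velocity x y t <> (0, 0) }.

(* [pass c true] and [pass c false] are the two preimages of the double point
   [c] in the parametrizing circle.  At a classical crossing [true] labels the
   passage along the over-strand and [false] the one along the under-strand;
   at a virtual crossing the labelling carries no information.
   [vd_double_points] and [pass_inj] say together that there are no multiple
   points other than the listed ones and that these are exactly double. *)
Record vdiagram := VDiagram {
  xcoord : R -> R;
  ycoord : R -> R;
  vd_immersion : closed_immersion xcoord ycoord;
  classical : finType;
  virtual : finType;
  pass : classical + virtual -> bool -> R;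
  pass_range : forall c k, 0 <= pass c k < 1;
  pass_inj : forall c k c' k', pass c k = pass c' k' -> c = c' /\ k = k';
  pass_double : forall c, xcoord (pass c true) = xcoord (pass c false) /\
                          ycoord (pass c true) = ycoord (pass c false);
  vd_double_points : forall s t : R, 0 <= s < 1 -> 0 <= t < 1 -> s <> t ->
    xcoord s = xcoord t -> ycoord s = ycoord t ->
    exists c k, s = pass c k /\ t = pass c (~~ k);
  vd_transversal : forall c,
    frame_det (velocity xcoord ycoord (pass c true))
              (velocity xcoord ycoord (pass c false)) != 0 }.

(* The arc [s, t[ of the circle, run from s to t along the orientation; it is
   the whole circle when s = t. *)
Definition on_arc (s t p : R) : bool :=
  if s < t then (s <= p) && (p < t) else (s <= p) || (p < t).

(* The arc length takes its values in ]0, 1], and arc_length s s = 1, so that the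
   next vertex after the only vertex of a core cycle is that vertex itself. *)
Definition arc_length (s t : R) : R := if s < t then t - s else t - s + 1.

Section Diagram.
Variable D : vdiagram.

Definition direction (c : classical D + virtual D) (k : bool) : R * R :=
  velocity (xcoord D) (ycoord D) (pass c k).

(* At the passage [k] through [c], the other strand crosses from right to left
   (resp. from left to right) when its velocity points to the left (resp. to
   the right) of the velocity of the current strand. *)
Definition other_right_to_left (c : classical D + virtual D) (k : bool) : bool :=
  0 < frame_det (direction c k) (direction c (~~ k)).

Definition other_left_to_right (c : classical D + virtual D) (k : bool) : bool :=
  frame_det (direction c k) (direction c (~~ k)) < 0.

(* The vertices of the core cycle are the preimages of the classical crossings.
   The second summand is empty, except when there is no classical crossing: it
   then has one element, a base point on the circle, so that the core cycle is
   a loop with one vertex and one edge. *)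
Definition gauss_vertex : finType :=
  (classical D * bool + 'I_(#|classical D| == 0%N))%type.

Definition vertex_param (v : gauss_vertex) : R :=
  match v with inl (c, k) => pass (inl c) k | inr _ => 0 end.

Definition next_vertex (v : gauss_vertex) : gauss_vertex :=
  [arg min_(w < v) arc_length (vertex_param v) (vertex_param w)]%O.

(* [inl v] is the core edge (long arc) that leaves [v]; [inr c] is a chord. *)
Definition gauss_edge : finType := (gauss_vertex + classical D)%type.

Definition gauss_tail (e : gauss_edge) : gauss_vertex :=
  match e with inl v => v | inr c => inl (c, true) end.

Definition gauss_head (e : gauss_edge) : gauss_vertex :=
  match e with inl v => next_vertex v | inr c => inl (c, false) end.

Definition gauss_diagram : digraph := Digraph gauss_tail gauss_head.

Definition core_edge (v : gauss_vertex) : edge gauss_diagram := inl v.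
Definition chord (c : classical D) : edge gauss_diagram := inr c.

(* No classical preimage is a virtual passage, so it does not matter that
   [on_arc] contains the initial point of the long arc; in the absence of
   classical crossings this makes the only long arc contain all passages. *)
Definition virtual_index (e : gauss_edge) : int :=
  match e with
  | inl v =>
    \sum_(p : virtual D * bool | on_arc (vertex_param v)
            (vertex_param (next_vertex v)) (pass (inr p.1) p.2))
      (if other_right_to_left (inr p.1) p.2 then 1 else -1)
  | inr _ => 0
  end.

Definition virtual_index_cocycle : cochain1 gauss_diagram :=
  [ffun e : gauss_edge => virtual_index e].

Definition virtual_index_class : set (cochain1 gauss_diagram) :=
  cohomology_class virtual_index_cocycle.

Definition crossing_sign (c : classical D) : int :=
  if 0 < frame_det (direction (inl c) true) (direction (inl c) false)
  then 1 else -1.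

(* Labels of the two strands a and b at c, named so that the frame
   (direction of a, direction of b) is positive. *)
Definition strand_a (c : classical D) : bool :=
  0 < frame_det (direction (inl c) true) (direction (inl c) false).
Definition strand_b (c : classical D) : bool := ~~ strand_a c.

Definition on_left_half (c : classical D) (p : R) : bool :=
  on_arc (pass (inl c) (strand_b c)) (pass (inl c) (strand_a c)) p.

Definition on_right_half (c : classical D) (p : R) : bool :=
  on_arc (pass (inl c) (strand_a c)) (pass (inl c) (strand_b c)) p.

Definition on_positive_half (c : classical D) (p : R) : bool :=
  if crossing_sign c == 1 then on_left_half c p else on_right_half c p.

Definition crossing_index (c : classical D) : int :=
  \sum_(p : classical D * bool |
          (p.1 != c) && on_positive_half c (pass (inl p.1) p.2))
    (if other_left_to_right (inl p.1) p.2 then 1 else -1).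

End Diagram.
End PlaneCurves.

Arguments virtual_index_cocycle {R} D.
Arguments virtual_index_class {R} D.
Arguments crossing_index {R} D c.

(* Main.v *)
Require Import Defs.
From mathcomp Require Import all_boot all_order all_algebra.
From mathcomp Require Import all_classical all_reals all_analysis.
From mathcomp Require Import ring lra zify.
Import Order.TTheory GRing.Theory Num.Theory.
Import numFieldNormedType.Exports.
Local Open Scope classical_set_scope.
Local Open Scope ring_scope.

Set Implicit Arguments.
Unset Strict Implicit.
Unset Printing Implicit Defensive.

(** Existence and uniqueness of the cocycle come from the two passages through
    a virtual crossing having opposite signs: the signs of all virtual passages
    add up to 0, so the sign count of an arc from [s] to [t] is the difference
    of the counts of the passages before [t] and before [s]
    ([sign_count_arc]).  On the core cycle [vi_D] is therefore the coboundary
    of a function [B] of the vertices, and [vi_D - delta B] is the required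
    cocycle.  Since a function invariant under [next_vertex] is constant
    ([next_vertex_constant]), the primitive is unique up to a constant, and the
    value at the chord [c] is forced: it is the sign count of the virtual
    passages of the arc from the undercrossing to the overcrossing of [c].
    Whatever the sign of [c], this arc is the half [D^+_c].

    The value agrees with the index of [c] because the signs of all passages of
    this arc, classical ones other than [c] and virtual ones together, add up
    to 0 ([sum_signs_half]).  Crossings passed twice by the arc cancel.  What
    remains is the algebraic intersection number of the two closed loops into
    which the knot is cut at [c], and the core of the proof is that two such
    loops of the plane have intersection number 0 ([sum_mutual_crossings]).

    For two loops [gamma] on [[a, b]] and on [[b, e]], the intersection points
    are the zeros of [F (s, t) = gamma s - gamma t] on the rectangle
    [[a, b] x [b, e]], and the local degree of [F] at a zero is the opposite of
    the sign of the crossing.  The degree is counted discretely.  The rectangle is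
    cut by a fine grid, and the turning of [F] around a cell counts, with signs,
    the edges whose image jumps across the positive horizontal axis.
    - The sum over all cells telescopes to the boundary
      ([sum_cell_turning]), where opposite sides cancel because both loops are
      closed.
    - A cell whose four vertices are sent into an open half-plane contributes 0
      ([cell_turning_half_plane]).  Away from the zeros this holds by
      compactness ([far_cell_turning]).
    - The cells of a small block around a zero contribute together the local
      degree, because [F] is nearly linear there ([block_turning]).
    - At the corners of the rectangle [F] vanishes too, as both loops pass
      through [c]; but the loops turn there without crossing, [F] stays in a
      half-plane, and the corners contribute 0 ([corner_cell_turning]). *)

(** * Discrete turning number of a grid of plane vectors *)

Section DiscreteTurning.
Variable R : realType.
Implicit Types p q u v : R * R.

(** The signed number of intersections of the segment from [p] to [q] with the
    positive half of the horizontal axis, counted positively upwards.  The axis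
    itself belongs to the upper side. *)
Definition axis_crossing p q : int :=
  if (0 <= p.2) == (0 <= q.2) then 0
  else if 0 <= q.2 then (0 < frame_det p q)%R%:R else - (frame_det p q < 0)%R%:R.

Definition upper p : int := (0 <= p.2)%R%:R.

Definition in_half_plane (al be : R) p : bool := 0 < al * p.1 + be * p.2.

(** A half-plane [0 < al * x + be * y] contains at most one of the two halves of
    the horizontal axis, the positive one exactly when [0 < al].  Inside it a
    change of side is therefore either always or never a crossing of the positive
    half, so that [axis_crossing] has a primitive. *)
Lemma axis_crossing_half_plane al be p q :
  in_half_plane al be p -> in_half_plane al be q ->
  axis_crossing p q = if 0 < al then upper q - upper p else 0.
Proof.
rewrite /in_half_plane /axis_crossing /upper /frame_det => hp hq.
case: (leP 0 p.2) => p2; case: (leP 0 q.2) => q2; rewrite ?eqxx /= ?subrr.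
- by case: ifP.
- case: (ltgtP 0 al) => [al0|al0|al0].
  + by rewrite sub0r; have -> : p.1 * q.2 - p.2 * q.1 < 0 by nra.
  + by have -> : p.1 * q.2 - p.2 * q.1 < 0 = false by apply/negbTE; rewrite -leNgt; nra.
  + have: 0 < be * p.2 by rewrite -al0 mul0r add0r in hp.
    have: 0 < be * q.2 by rewrite -al0 mul0r add0r in hq.
    by move=> *; exfalso; nra.
- case: (ltgtP 0 al) => [al0|al0|al0].
  + by rewrite subr0; have -> : 0 < p.1 * q.2 - p.2 * q.1 by nra.
  + by have -> : 0 < p.1 * q.2 - p.2 * q.1 = false by apply/negbTE; rewrite -leNgt; nra.
  + have: 0 < be * p.2 by rewrite -al0 mul0r add0r in hp.
    have: 0 < be * q.2 by rewrite -al0 mul0r add0r in hq.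
    by move=> *; exfalso; nra.
- by case: ifP.
Qed.

Lemma sum_axis_crossing_half_plane al be (f : nat -> R * R) (m n : nat) :
  (m <= n)%N -> (forall i, (m <= i <= n)%N -> in_half_plane al be (f i)) ->
  \sum_(m <= i < n) axis_crossing (f i) (f i.+1) =
  if 0 < al then upper (f n) - upper (f m) else 0.
Proof.
move=> mn fP; transitivity
    (\sum_(m <= i < n) (if 0 < al then upper (f i.+1) - upper (f i) else 0)).
  apply: eq_big_nat => i /andP[mi iN].
  by apply: (axis_crossing_half_plane (be := be)); apply: fP;
    rewrite ?mi ?(ltnW iN) ?(leqW mi).
by case: ifP => _; [rewrite telescope_sumr|rewrite big1].
Qed.

Definition cell_turning (G : nat -> nat -> R * R) (i j : nat) : int :=
  axis_crossing (G i j) (G i.+1 j) + axis_crossing (G i.+1 j) (G i.+1 j.+1)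
  - axis_crossing (G i j.+1) (G i.+1 j.+1) - axis_crossing (G i j) (G i j.+1).

Lemma cell_turning_half_plane al be G i j :
  (forall i' j', (i <= i' <= i.+1)%N -> (j <= j' <= j.+1)%N ->
    in_half_plane al be (G i' j')) ->
  cell_turning G i j = 0.
Proof.
move=> h; rewrite /cell_turning.
have h00 : in_half_plane al be (G i j) by apply: h; rewrite leqnn leqnSn.
have h10 : in_half_plane al be (G i.+1 j) by apply: h; rewrite leqnn leqnSn.
have h01 : in_half_plane al be (G i j.+1) by apply: h; rewrite leqnn leqnSn.
have h11 : in_half_plane al be (G i.+1 j.+1) by apply: h; rewrite leqnn leqnSn.
rewrite (axis_crossing_half_plane h00 h10) (axis_crossing_half_plane h10 h11).
rewrite (axis_crossing_half_plane h01 h11) (axis_crossing_half_plane h00 h01).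
by case: ifP => _; ring.
Qed.

(** A discrete Green formula: each interior edge of the grid is run in opposite
    directions by the two cells that contain it. *)
Lemma sum_cell_turning G (i0 i1 j0 j1 : nat) : (i0 <= i1)%N -> (j0 <= j1)%N ->
  \sum_(i0 <= i < i1) \sum_(j0 <= j < j1) cell_turning G i j =
  \sum_(i0 <= i < i1) axis_crossing (G i j0) (G i.+1 j0)
  + \sum_(j0 <= j < j1) axis_crossing (G i1 j) (G i1 j.+1)
  - \sum_(i0 <= i < i1) axis_crossing (G i j1) (G i.+1 j1)
  - \sum_(j0 <= j < j1) axis_crossing (G i0 j) (G i0 j.+1).
Proof.
move=> i01 j01.
pose H i j := axis_crossing (G i j) (G i.+1 j).
pose V i := \sum_(j0 <= j < j1) axis_crossing (G i j) (G i j.+1).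
transitivity (\sum_(i0 <= i < i1) ((V i.+1 - V i) - (H i j1 - H i j0))).
  apply: eq_bigr => i _; rewrite -(telescope_sumr (H i) j01) /V -!sumrB.
  by apply: eq_bigr => j _; rewrite /cell_turning /H; ring.
rewrite sumrB (telescope_sumr V i01) sumrB /V /H; ring.
Qed.

Lemma cramer u v (c d : R) : frame_det u v != 0 ->
  exists al be, al * u.1 + be * u.2 = c /\ al * v.1 + be * v.2 = d.
Proof.
rewrite /frame_det => D0.
exists ((c * v.2 - d * u.2) / (u.1 * v.2 - u.2 * v.1)).
exists ((d * u.1 - c * v.1) / (u.1 * v.2 - u.2 * v.1)).
by split; field.
Qed.

(** The local degree of a linear map.  The hypotheses say that
    [(a1, b1)], [(a2, b2)] is the basis dual to [u, v] and that the four sides of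
    the block are sent to the half-planes where the values of
    [(s, t) |-> s *: u - t *: v] on the sides of a square centered at the origin
    lie. *)
Lemma block_turning u v a1 b1 a2 b2 (G : nat -> nat -> R * R) (i0 i1 j0 j1 : nat) :
  a1 * u.1 + b1 * u.2 = 1 -> a1 * v.1 + b1 * v.2 = 0 ->
  a2 * u.1 + b2 * u.2 = 0 -> a2 * v.1 + b2 * v.2 = 1 ->
  (i0 <= i1)%N -> (j0 <= j1)%N ->
  (forall i, (i0 <= i <= i1)%N -> in_half_plane a2 b2 (G i j0)) ->
  (forall j, (j0 <= j <= j1)%N -> in_half_plane a1 b1 (G i1 j)) ->
  (forall i, (i0 <= i <= i1)%N -> in_half_plane (- a2) (- b2) (G i j1)) ->
  (forall j, (j0 <= j <= j1)%N -> in_half_plane (- a1) (- b1) (G i0 j)) ->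
  \sum_(i0 <= i < i1) \sum_(j0 <= j < j1) cell_turning G i j =
  if 0 < frame_det u v then -1 else 1.
Proof.
move=> h1 h2 h3 h4 i01 j01 hb hr ht hl.
rewrite sum_cell_turning // (sum_axis_crossing_half_plane i01 hb).
rewrite (sum_axis_crossing_half_plane j01 hr) (sum_axis_crossing_half_plane i01 ht).
rewrite (sum_axis_crossing_half_plane j01 hl).
have i0i : (i0 <= i0 <= i1)%N by rewrite leqnn.
have i1i : (i0 <= i1 <= i1)%N by rewrite i01 leqnn.
have j0j : (j0 <= j0 <= j1)%N by rewrite leqnn.
have j1j : (j0 <= j1 <= j1)%N by rewrite j01 leqnn.
move: (hb _ i0i) (hb _ i1i) (hr _ j0j) (hr _ j1j).
move: (ht _ i0i) (ht _ i1i) (hl _ j0j) (hl _ j1j).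
rewrite /upper /in_half_plane.
move: (G i0 j0) (G i0 j1) (G i1 j0) (G i1 j1).
(* The images of the vertices are p and r (bottom left and right), q and s (top
   left and right). *)
move=> [p1 p2] [q1 q2] [r1 r2] [s1 s2] /=; clear hb hr ht hl.
have D1 : frame_det u v * (a1 * b2 - b1 * a2) = 1.
  rewrite /frame_det; transitivity ((a1 * u.1 + b1 * u.2) * (a2 * v.1 + b2 * v.2) -
     (a1 * v.1 + b1 * v.2) * (a2 * u.1 + b2 * u.2)); first by ring.
  by rewrite h1 h2 h3 h4; ring.
have -> : (0 < frame_det u v) = (0 < a1 * b2 - b1 * a2).
  by apply/idP/idP => ?; nra.
have : a1 * b2 - b1 * a2 != 0.
  by apply/eqP => e; move: D1; rewrite e; lra.
clear D1 h1 h2 h3 h4.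
set D := a1 * b2 - b1 * a2 => D0.
(* The height of a vertex is a combination of its two dual coordinates, whose
   signs are known. *)
have side (x1 x2 : R) y : y = a1 * (a2 * x1 + b2 * x2) - a2 * (a1 * x1 + b1 * x2) ->
    y != 0 -> (0 <= x2) = ((0 < y) == (0 < D)).
  have -> : a1 * (a2 * x1 + b2 * x2) - a2 * (a1 * x1 + b1 * x2) = D * x2.
    by rewrite /D; ring.
  move=> -> /[!mulf_eq0] /norP[_ x0].
  case: (ltgtP 0 D) D0 => // D0 _.
    by rewrite pmulr_rgt0 // eqb_id le0r (negbTE x0).
  by rewrite nmulr_rgt0 // eqbF_neg -leNgt.
rewrite !mulNr -!opprD !oppr_gt0.
move: (side p1 p2 _ erefl) (side q1 q2 _ erefl) (side r1 r2 _ erefl) (side s1 s2 _ erefl).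
clear side.
move: (a1 * p1 + b1 * p2) (a1 * q1 + b1 * q2) (a1 * r1 + b1 * r2) (a1 * s1 + b1 * s2).
move: (a2 * p1 + b2 * p2) (a2 * q1 + b2 * q2) (a2 * r1 + b2 * r2) (a2 * s1 + b2 * s2).
move=> P2 Q2 R2 S2 P1 Q1 R1 S1 sP sQ sR sS lQ2 lS2 lP1 lQ1 lP2 lR2 lR1 lS1.
have aa : (a1 != 0) || (a2 != 0).
  rewrite -negb_and; apply: contra D0 => /andP[/eqP e1 /eqP e2].
  by rewrite /D e1 e2; apply/eqP; ring.
have val (y x : R) : (y != 0 -> (0 <= x) = ((0 < y) == (0 < D))) ->
    (0 < y -> (0 <= x) = (0 < D)) /\ (y < 0 -> (0 <= x) = ~~ (0 < D)).
  move=> yx; split=> y0.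
    by rewrite yx ?(lt0r_neq0 y0) // y0.
  by rewrite yx ?(ltr0_neq0 y0) // (lt_gtF y0).
move: (val _ _ sP) (val _ _ sQ) (val _ _ sR) (val _ _ sS).
move=> {sP sQ sR sS val} [sP nP] [sQ nQ] [sR nR] [sS nS].
(* The signs of a1 and a2 decide which sides of the block can cross the positive
   axis.  In each case the contributions add up to a difference between the sides
   of the axis of two vertices, known from their dual coordinates. *)
case: (ltgtP 0 a1) aa => [a1p|a1n|a10] aa; case: (ltgtP 0 a2) aa => [a2p|a2n|a20] // aa.
- have -> : (0 <= p2) = (0 < D) by apply: sP; move: a1p a2p lP1 lP2; clear=> *; nra.
  have -> : (0 <= s2) = ~~ (0 < D) by apply: nS; move: a1p a2p lS1 lS2; clear=> *; nra.
  by case: (0 < D) => /=; ring.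
- have -> : (0 <= q2) = ~~ (0 < D) by apply: nQ; move: a1p a2n lQ1 lQ2; clear=> *; nra.
  have -> : (0 <= r2) = (0 < D) by apply: sR; move: a1p a2n lR1 lR2; clear=> *; nra.
  by case: (0 < D) => /=; ring.
- have -> : (0 <= s2) = ~~ (0 < D) by apply: nS; move: a1p a20 lS1 lS2; clear=> *; nra.
  have -> : (0 <= r2) = (0 < D) by apply: sR; move: a1p a20 lR1 lR2; clear=> *; nra.
  by case: (0 < D) => /=; ring.
- have -> : (0 <= r2) = ~~ (0 < D) by apply: nR; move: a1n a2p lR1 lR2; clear=> *; nra.
  have -> : (0 <= q2) = (0 < D) by apply: sQ; move: a1n a2p lQ1 lQ2; clear=> *; nra.
  by case: (0 < D) => /=; ring.
- have -> : (0 <= p2) = ~~ (0 < D) by apply: nP; move: a1n a2n lP1 lP2; clear=> *; nra.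
  have -> : (0 <= s2) = (0 < D) by apply: sS; move: a1n a2n lS1 lS2; clear=> *; nra.
  by case: (0 < D) => /=; ring.
- have -> : (0 <= p2) = ~~ (0 < D) by apply: nP; move: a1n a20 lP1 lP2; clear=> *; nra.
  have -> : (0 <= q2) = (0 < D) by apply: sQ; move: a1n a20 lQ1 lQ2; clear=> *; nra.
  by case: (0 < D) => /=; ring.
- have -> : (0 <= p2) = (0 < D) by apply: sP; move: a10 a2p lP1 lP2; clear=> *; nra.
  have -> : (0 <= r2) = ~~ (0 < D) by apply: nR; move: a10 a2p lR1 lR2; clear=> *; nra.
  by case: (0 < D) => /=; ring.
- have -> : (0 <= q2) = ~~ (0 < D) by apply: nQ; move: a10 a2n lQ1 lQ2; clear=> *; nra.
  have -> : (0 <= s2) = (0 < D) by apply: sS; move: a10 a2n lS1 lS2; clear=> *; nra.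
  by case: (0 < D) => /=; ring.
Qed.
(** The grid values being equal on opposite sides of the grid, the total turning
    is 0, and it is carried by the blocks that cover all cells of nonzero
    turning. *)
Lemma sum_block_turning (I : finType) (P : pred I) (K : nat)
    (G : nat -> nat -> R * R) (i0 i1 j0 j1 : I -> nat) :
  (forall i, G i K = G i 0%N) -> (forall j, G K j = G 0%N j) ->
  (forall z, P z -> (i1 z <= K)%N /\ (j1 z <= K)%N) ->
  (forall i j, (i < K)%N -> (j < K)%N -> cell_turning G i j <> 0 ->
     exists z, [/\ P z, (i0 z <= i < i1 z)%N & (j0 z <= j < j1 z)%N]) ->
  (forall z z' i, P z -> P z' -> (i0 z <= i < i1 z)%N -> (i0 z' <= i < i1 z')%N ->
     z = z') ->
  \sum_(z | P z) \sum_(i0 z <= i < i1 z) \sum_(j0 z <= j < j1 z) cell_turning G i j = 0.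
Proof.
move=> GK KG ub cover disj.
have tot : \sum_(0 <= i < K) \sum_(0 <= j < K) cell_turning G i j = 0.
  rewrite sum_cell_turning //.
  under eq_bigr do rewrite -!GK.
  under [X in _ + X - _ - _]eq_bigr do rewrite !KG.
  by ring.
have widen (m n : nat) (f : nat -> int) : (n <= K)%N ->
    \sum_(m <= i < n) f i = \sum_(0 <= i < K) (if (m <= i < n)%N then f i else 0).
  move=> nK; rewrite -big_mkcond (big_nat_widenl m 0%N) //.
  by rewrite (big_nat_widen 0%N n K) //; apply: eq_bigl => i; rewrite andbC.
apply: etrans tot.
transitivity (\sum_(0 <= i < K) \sum_(0 <= j < K) \sum_(z | P z)
   (if (i0 z <= i < i1 z)%N then
     if (j0 z <= j < j1 z)%N then cell_turning G i j else 0 else 0)).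
  transitivity (\sum_(0 <= i < K) \sum_(z | P z) \sum_(0 <= j < K)
   (if (i0 z <= i < i1 z)%N then
     if (j0 z <= j < j1 z)%N then cell_turning G i j else 0 else 0)).
    rewrite [RHS]exchange_big /=; apply: eq_bigr => z Pz.
    have [zi zj] := ub _ Pz.
    rewrite widen //; apply: eq_bigr => i _.
    by case: ifP => _; [rewrite widen|rewrite big1].
  by apply: eq_bigr => i _; rewrite exchange_big.
apply: eq_big_nat => i /andP[_ iK]; apply: eq_big_nat => j /andP[_ jK].
have [c0|/eqP c0] := eqVneq (cell_turning G i j) 0.
  by rewrite big1 // => z _; rewrite c0 !if_same.
have [z [Pz zi zj]] := cover i j iK jK c0.
rewrite (bigD1 z) //= zi zj big1 ?addr0 // => z' /andP[Pz' z'z].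
by case: ifPn => // z'i; rewrite (disj z' z i) ?eqxx in z'z.
Qed.

End DiscreteTurning.

(** * Uniform subdivisions of a segment *)

Section Grid.
Variable R : realType.

Lemma grid_index (g : nat -> R) (h v : R) (K : nat) : 0 <= h ->
  (forall i, g i.+1 <= g i + h) -> g 0%N <= v <= g K ->
  exists2 n, (n <= K)%N & v - h <= g n <= v.
Proof.
move=> h0 gS; elim: K => [|K IH] /andP[g0v vK].
  by exists 0%N => //; rewrite g0v andbT; lra.
have [vK'|Kv] := leP v (g K).
  by have [|n nK ?] := IH; [rewrite g0v|exists n => //; exact: leqW].
exists K => //; rewrite (ltW Kv) andbT.
by have := gS K; lra.
Qed.

Definition grid (a b : R) (K i : nat) : R := a + i%:R * ((b - a) / K%:R).

Lemma grid0 a b K : grid a b K 0 = a.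
Proof. by rewrite /grid mul0r addr0. Qed.

Lemma gridK a b K : (0 < K)%N -> grid a b K K = b.
Proof. by move=> K0; rewrite /grid mulrC divfK ?pnatr_eq0 -?lt0n //; ring. Qed.

Lemma le_grid a b K i j : a <= b -> (i <= j)%N -> grid a b K i <= grid a b K j.
Proof.
by move=> ab ij; rewrite lerD2l ler_wpM2r ?ler_nat // divr_ge0 ?subr_ge0.
Qed.

Lemma grid_itv a b K i : a <= b -> (0 < K)%N -> (i <= K)%N -> a <= grid a b K i <= b.
Proof.
move=> ab K0 iK; apply/andP; split.
  by rewrite -{1}(grid0 a b K) le_grid.
by rewrite -{2}(gridK a b K0) le_grid.
Qed.

Lemma gridS a b K i : grid a b K i.+1 = grid a b K i + (b - a) / K%:R.
Proof. by rewrite /grid -natr1; ring. Qed.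

Lemma grid_step a b h K i j : a <= b -> (b - a) / K%:R <= h ->
  (i <= j <= i.+1)%N -> grid a b K i <= grid a b K j <= grid a b K i + h.
Proof.
move=> ab bh /andP[ij ji]; rewrite le_grid //=.
by apply: le_trans (le_grid K ab ji) _; rewrite gridS lerD2l.
Qed.

(** The indices of the grid points in a window around [c].  The window ends
    between [3 d / 4] and [d] away from [c], so that a cell based at a point
    within [d / 2] of [c] is inside the window while the ends stay away
    from [c]. *)
Lemma grid_window (a b c d : R) (K : nat) : a <= b -> (0 < K)%N -> 0 < d ->
  (b - a) / K%:R <= d / 4 -> a <= c - d -> c + d <= b ->
  exists i0 i1, [/\ (i0 <= i1 <= K)%N,
    grid a b K i0 <= c - d * 3 / 4, c + d * 3 / 4 <= grid a b K i1,
    forall i, (i0 <= i <= i1)%N -> `|grid a b K i - c| <= d &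
    forall i, `|grid a b K i - c| < d / 2 -> (i0 <= i < i1)%N].
Proof.
move=> ab K0 d0 hd acd cdb.
have h0 : 0 <= (b - a) / K%:R by rewrite divr_ge0 ?subr_ge0.
have gS i : grid a b K i.+1 <= grid a b K i + (b - a) / K%:R by rewrite gridS.
have v0 : grid a b K 0 <= c - d * 3 / 4 <= grid a b K K.
  by rewrite grid0 gridK //; apply/andP; split; lra.
have v1 : grid a b K 0 <= c + d <= grid a b K K.
  by rewrite grid0 gridK //; apply/andP; split; lra.
have [i0 i0K /andP[i0l i0r]] := grid_index h0 gS v0.
have [i1 i1K /andP[i1l i1r]] := grid_index h0 gS v1.
exists i0, i1; split.
- rewrite i1K andbT leqNgt; apply/negP => /ltnW/(le_grid K ab); lra.
- by [].
- by lra.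
- move=> i /andP[/(le_grid K ab) h1 /(le_grid K ab) h2].
  by rewrite ler_norml; apply/andP; split; lra.
- move=> i; rewrite ltr_norml => /andP[h1 h2].
  apply/andP; split; first by rewrite leqNgt; apply/negP => /ltnW/(le_grid K ab); lra.
  by rewrite ltnNge; apply/negP => /(le_grid K ab); lra.
Qed.

Lemma ball_step (c d u u' : R) :
  ball c (d / 2) u -> u <= u' <= u + d / 4 -> `|u' - c| <= d.
Proof.
rewrite /ball /= ltr_norml ler_norml => /andP[? ?] /andP[? ?].
by apply/andP; split; lra.
Qed.

End Grid.

(** * First order expansions, Lipschitz bounds and compactness *)

Section Analysis.
Variable R : realType.

Lemma derivable_linear_approx (f : R -> R) (p eps : R) :
  derivable f p 1 -> 0 < eps ->
  \forall d \near 0^'+, forall t, `|t - p| <= d ->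
    `|f t - f p - derive1 f p * (t - p)| <= eps * `|t - p|.
Proof.
move=> df e0.
have : h^-1 *: (f (h *: 1 + p) - f p) @[h --> 0^'] --> derive1 f p.
  by rewrite derive1E; exact: df.
move=> /cvgrPdist_le/(_ _ e0).
rewrite /prop_near1 /= nbhs_nearE.
move=> /nbhs_ballP[r /= r0 hr].
near=> d => t td.
have [->|tp] := eqVneq t p; first by rewrite !subrr mulr0 subr0 normr0 mulr0.
have tp0 : t - p != 0 by rewrite subr_eq0.
have := hr (t - p); rewrite /ball /= sub0r normrN => /(_ _ tp0).
rewrite /GRing.scale /= mulr1 subrK => {}hr.
have -> : f t - f p - derive1 f p * (t - p) =
    - ((derive1 f p - (t - p)^-1 * (f t - f p)) * (t - p)) by field.
rewrite normrN normrM; apply: ler_wpM2r => //.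
apply: hr; apply: le_lt_trans td _.
near: d; exact: nbhs_right_lt.
Unshelve. all: by end_near. Qed.

Lemma lipschitz_segment (f : R -> R) (a b : R) : a <= b ->
  (forall t : R, derivable f t 1) -> continuous (derive1 f) ->
  exists2 k, 0 < k & forall s t, a <= s <= b -> a <= t <= b ->
    `|f s - f t| <= k * `|s - t|.
Proof.
move=> ab df cf.
have cn : {within `[a, b], continuous (fun t => `|derive1 f t|)}.
  apply: continuous_subspaceT => t; apply: cvg_norm; exact: cf.
have [c _ hc] := EVT_max ab cn.
exists (`|derive1 f c| + 1); first by rewrite ltr_wpDl.
have main s t : a <= s -> s <= t -> t <= b ->
    `|f t - f s| <= (`|derive1 f c| + 1) * `|t - s|.
  move=> as_ st tb.
  have dfs u : u \in `]s, t[%R -> is_derive u 1 f (derive1 f u).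
    by move=> _; rewrite derive1E; apply: DeriveDef => //; exact: df.
  have cfs : {within `[s, t], continuous f}.
    by apply: derivable_within_continuous => u _; exact: df.
  have [d dst ->] := MVT_segment st dfs cfs.
  rewrite normrM ler_wpM2r //.
  have dab : d \in `[a, b]%R.
    move: dst; rewrite !in_itv /= => /andP[sd dt].
    by rewrite (le_trans as_ sd) (le_trans dt tb).
  by have := hc d dab; lra.
move=> s t /andP[as_ sb] /andP[at_ tb].
have [st|/ltW ts] := leP s t; last exact: main.
by rewrite distrC (distrC s); exact: main.
Qed.

Lemma compact_norm_bounded_away (C : set (R * R)) (F : R * R -> R * R) :
  compact C -> continuous F -> (forall p, C p -> F p <> 0) ->
  exists2 m, 0 < m & forall p, C p -> m <= `|F p|.
Proof.
move=> cC cF F0.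
have [->|/set0P[p0 Cp0]] := eqVneq C set0; first by exists 1.
have cI : {within C, continuous (fun p => `|F p|)}.
  by apply: continuous_subspaceT => p; apply: cvg_norm; exact: cF.
have C0 : C !=set0 by exists p0.
have [c cC' hc] := compact_EVT_min C0 cC cI.
exists `|F c|; first by rewrite normr_gt0; apply/eqP/F0; rewrite -inE.
by move=> p Cp; apply: hc; rewrite inE.
Qed.

(** A square centered at [p] that does not contain the origin is separated from
    the origin by one of its sides. *)
Lemma half_plane_of_square (p : R * R) (m : R) : 0 < m -> m <= `|p| ->
  exists al bt, forall q, `|q.1 - p.1| < m -> `|q.2 - p.2| < m ->
    0 < al * q.1 + bt * q.2.
Proof.
move=> m0; rewrite prod_normE le_max => /orP[] /=; rewrite ler_normr => /orP[] far.
- by exists 1, 0 => q; rewrite ltr_norml => /andP[? ?] _; lra.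
- by exists (-1), 0 => q; rewrite ltr_norml => /andP[? ?] _; lra.
- by exists 0, 1 => q _; rewrite ltr_norml => /andP[? ?]; lra.
- by exists 0, (-1) => q _; rewrite ltr_norml => /andP[? ?]; lra.
Qed.

Lemma lipschitz_difference_osc (f : R -> R) (k h s0 s1 t0 t1 : R) : 0 < k ->
  `|f s1 - f s0| <= k * `|s1 - s0| -> `|f t1 - f t0| <= k * `|t1 - t0| ->
  s0 <= s1 <= s0 + h -> t0 <= t1 <= t0 + h ->
  `|(f s1 - f t1) - (f s0 - f t0)| <= 2 * k * h.
Proof.
move=> k0 l1 l2 /andP[s01 s10] /andP[t01 t10].
have -> : f s1 - f t1 - (f s0 - f t0) = (f s1 - f s0) - (f t1 - f t0) by ring.
apply: le_trans (ler_normB _ _) _; apply: le_trans (lerD l1 l2) _.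
rewrite !ger0_norm ?subr_ge0 // -mulrDr -mulrA mulrCA ler_pM2l //; lra.
Qed.

End Analysis.

(** * The intersection number of two loops with a common point is zero *)

Section TwoLoops.
Variable R : realType.
Variables x y : R -> R.
Hypothesis dx : forall t : R, derivable x t 1.
Hypothesis dy : forall t : R, derivable y t 1.

Lemma combination_linear_approx (al be p eps : R) : 0 < eps ->
  \forall d \near 0^'+, forall t, `|t - p| <= d ->
    `|al * (x t - x p) + be * (y t - y p)
      - (al * derive1 x p + be * derive1 y p) * (t - p)| <= eps * `|t - p|.
Proof.
move=> e0.
have k0 : 0 < `|al| + `|be| + 1 by rewrite ltr_wpDl // addr_ge0.
have e'0 : 0 < eps / (`|al| + `|be| + 1) by rewrite divr_gt0.
near=> d => t td.
have hx : `|x t - x p - derive1 x p * (t - p)| <= eps / (`|al| + `|be| + 1) * `|t - p|.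
  by move: t td; near: d; exact: derivable_linear_approx.
have hy : `|y t - y p - derive1 y p * (t - p)| <= eps / (`|al| + `|be| + 1) * `|t - p|.
  by move: t td {hx}; near: d; exact: derivable_linear_approx.
have -> : al * (x t - x p) + be * (y t - y p)
      - (al * derive1 x p + be * derive1 y p) * (t - p) =
    al * (x t - x p - derive1 x p * (t - p)) + be * (y t - y p - derive1 y p * (t - p)).
  by ring.
apply: le_trans (ler_normD _ _) _; rewrite !normrM.
apply: le_trans (lerD (ler_wpM2l (normr_ge0 al) hx) (ler_wpM2l (normr_ge0 be) hy)) _.
rewrite -mulrDl mulrA; apply: ler_wpM2r => //.
rewrite mulrA ler_pdivrMr // mulrC; apply: ler_wpM2l; [exact: ltW|lra].
Unshelve. all: by end_near. Qed.

(** The difference vector [gamma s - gamma t], in the basis formed by the two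
    velocities at the crossing, is [(s - s0, t0 - t)] up to an error [d / 2].  The
    forms [(a1, b1)] and [(a2, b2)] give the coordinates in this basis. *)
Definition linear_at_crossing (s0 t0 d : R) := exists a1 b1 a2 b2, [/\
  a1 * derive1 x s0 + b1 * derive1 y s0 = 1 /\ a1 * derive1 x t0 + b1 * derive1 y t0 = 0,
  a2 * derive1 x s0 + b2 * derive1 y s0 = 0 /\ a2 * derive1 x t0 + b2 * derive1 y t0 = 1 &
  forall s t, `|s - s0| <= d -> `|t - t0| <= d ->
    `|a1 * (x s - x t) + b1 * (y s - y t) - (s - s0)| <= d / 2 /\
    `|a2 * (x s - x t) + b2 * (y s - y t) + (t - t0)| <= d / 2].

Lemma near_linear_at_crossing (s0 t0 : R) :
  frame_det (velocity x y s0) (velocity x y t0) != 0 -> x s0 = x t0 -> y s0 = y t0 ->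
  \forall d \near 0^'+, linear_at_crossing s0 t0 d.
Proof.
move=> det0 xst yst.
have [a1 [b1 [/= h1 h2]]] := cramer 1 0 det0.
have [a2 [b2 [/= h3 h4]]] := cramer 0 1 det0.
have e40 : 0 < 4^-1 :> R by rewrite invr_gt0.
have := combination_linear_approx a1 b1 s0 e40; rewrite h1 => N1.
have := combination_linear_approx a2 b2 s0 e40; rewrite h3 => N2.
have := combination_linear_approx a1 b1 t0 e40; rewrite h2 => N3.
have := combination_linear_approx a2 b2 t0 e40; rewrite h4 => N4.
near=> d; exists a1, b1, a2, b2; split=> // s t sd td.
have A1 : `|a1 * (x s - x s0) + b1 * (y s - y s0) - 1 * (s - s0)| <= 4^-1 * `|s - s0|.
  by move: s sd; near: d.
have A2 : `|a2 * (x s - x s0) + b2 * (y s - y s0) - 0 * (s - s0)| <= 4^-1 * `|s - s0|.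
  by move: s sd {A1}; near: d.
have A3 : `|a1 * (x t - x t0) + b1 * (y t - y t0) - 0 * (t - t0)| <= 4^-1 * `|t - t0|.
  by move: t td; near: d.
have A4 : `|a2 * (x t - x t0) + b2 * (y t - y t0) - 1 * (t - t0)| <= 4^-1 * `|t - t0|.
  by move: t td {A3}; near: d.
split.
- have -> : a1 * (x s - x t) + b1 * (y s - y t) - (s - s0) =
    (a1 * (x s - x s0) + b1 * (y s - y s0) - 1 * (s - s0))
    - (a1 * (x t - x t0) + b1 * (y t - y t0) - 0 * (t - t0)).
    by rewrite xst yst; ring.
  by apply: le_trans (ler_normB _ _) _; lra.
- have -> : a2 * (x s - x t) + b2 * (y s - y t) + (t - t0) =
    (a2 * (x s - x s0) + b2 * (y s - y s0) - 0 * (s - s0))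
    - (a2 * (x t - x t0) + b2 * (y t - y t0) - 1 * (t - t0)).
    by rewrite xst yst; ring.
  by apply: le_trans (ler_normB _ _) _; lra.
Unshelve. all: by end_near. Qed.

Definition difference (p : R * R) : R * R := (x p.1 - x p.2, y p.1 - y p.2).

Variables a b e : R.
Hypotheses (ab : a < b) (b_e : b < e).

(** A value 0 is replaced by [v], because [difference] vanishes at the corners of
    the rectangle: choosing [v] in the half-plane of the nearby values makes the
    corner cells ordinary cells. *)
Definition grid_value (v : R * R) (K i j : nat) : R * R :=
  let p := difference (grid a b K i, grid b e K j) in if p == 0 then v else p.

Lemma grid_value_half_plane v K al bt i j :
  0 < al * (x (grid a b K i) - x (grid b e K j)) +
    bt * (y (grid a b K i) - y (grid b e K j)) ->
  in_half_plane al bt (grid_value v K i j).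
Proof.
by rewrite /grid_value /in_half_plane; case: eqP => // -[-> ->]; rewrite !mulr0 addr0 ltxx.
Qed.

(** On each side of the block, one coordinate of the difference vector in the basis
    of velocities is at least [3 d / 4] in absolute value before the error [d / 2],
    which fixes its sign. *)
Lemma crossing_block_turning v K d s0 t0 i0 i1 j0 j1 :
  0 < d -> linear_at_crossing s0 t0 d -> (i0 <= i1)%N -> (j0 <= j1)%N ->
  grid a b K i0 <= s0 - d * 3 / 4 -> s0 + d * 3 / 4 <= grid a b K i1 ->
  grid b e K j0 <= t0 - d * 3 / 4 -> t0 + d * 3 / 4 <= grid b e K j1 ->
  (forall i, (i0 <= i <= i1)%N -> `|grid a b K i - s0| <= d) ->
  (forall j, (j0 <= j <= j1)%N -> `|grid b e K j - t0| <= d) ->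
  \sum_(i0 <= i < i1) \sum_(j0 <= j < j1) cell_turning (grid_value v K) i j =
  if 0 < frame_det (velocity x y s0) (velocity x y t0) then -1 else 1.
Proof.
move=> d0 [a1 [b1 [a2 [b2 [[e1 e2] [e3 e4] lin]]]]] i01 j01 si0 si1 tj0 tj1 sd td.
have [i0P i1P] : (i0 <= i0 <= i1)%N /\ (i0 <= i1 <= i1)%N by rewrite !leqnn i01.
have [j0P j1P] : (j0 <= j0 <= j1)%N /\ (j0 <= j1 <= j1)%N by rewrite !leqnn j01.
apply: (@block_turning R (velocity x y s0) (velocity x y t0) a1 b1 a2 b2
  (grid_value v K) _ _ _ _ e1 e2 e3 e4 i01 j01).
- move=> i iP; apply: grid_value_half_plane.
  have [_] := lin _ _ (sd i iP) (td j0 j0P).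
  move: d0 tj0; clear=> d0 tj0; rewrite ler_norml => /andP[]; lra.
- move=> j jP; apply: grid_value_half_plane.
  have [+ _] := lin _ _ (sd i1 i1P) (td j jP).
  move: d0 si1; clear=> d0 si1; rewrite ler_norml => /andP[]; lra.
- move=> i iP; apply: grid_value_half_plane.
  have [_] := lin _ _ (sd i iP) (td j1 j1P).
  move: d0 tj1; clear=> d0 tj1; rewrite ler_norml => /andP[]; lra.
- move=> j jP; apply: grid_value_half_plane.
  have [+ _] := lin _ _ (sd i0 i0P) (td j jP).
  move: d0 si0; clear=> d0 si0; rewrite ler_norml => /andP[]; lra.
Qed.

(** Near the double point shared by the two loops, a line through this point
    has the first loop on one side and the second loop on the other. *)
Definition separated_at_corners (al bt d : R) : Prop :=
  (forall s, a <= s <= b -> `|s - a| <= d \/ `|s - b| <= d ->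
    [\/ s = a, s = b | al * x a + bt * y a < al * x s + bt * y s]) /\
  (forall t, b <= t <= e -> `|t - b| <= d \/ `|t - e| <= d ->
    [\/ t = b, t = e | al * x t + bt * y t < al * x a + bt * y a]).

Hypothesis cdx : continuous (derive1 x).
Hypothesis cdy : continuous (derive1 y).
Hypothesis xab : x b = x a.
Hypothesis yab : y b = y a.
Hypothesis xae : x e = x a.
Hypothesis yae : y e = y a.
Hypothesis velocity_ae : velocity x y e = velocity x y a.
Hypothesis corner_transversal : frame_det (velocity x y a) (velocity x y b) != 0.

(** The form taking the values 1 and -1 at the two velocities of the double point
    separates the loops: the first loop leaves along [velocity x y a] and comes back
    along [velocity x y b], the second one leaves along [velocity x y b] and comes
    back along [velocity x y e = velocity x y a]. *)
Lemma near_corner : exists al bt : R,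
  0 < al * derive1 x a + bt * derive1 y a /\
  \forall d \near 0^'+, separated_at_corners al bt d.
Proof.
have [al [bt [/= h1 h2]]] := cramer 1 (-1) corner_transversal.
exists al, bt; split; first by rewrite h1.
have [h3x h3y] := velocity_ae.
have e20 : 0 < 2^-1 :> R by rewrite invr_gt0.
have := combination_linear_approx al bt a e20; rewrite h1 => N1.
have := combination_linear_approx al bt b e20; rewrite h2 => N2.
have := combination_linear_approx al bt e e20; rewrite h3x h3y h1 => N3.
near=> d.
have A1 : forall s, `|s - a| <= d ->
    `|al * (x s - x a) + bt * (y s - y a) - 1 * (s - a)| <= 2^-1 * `|s - a|.
  by near: d.
have A2 : forall s, `|s - b| <= d ->
    `|al * (x s - x b) + bt * (y s - y b) - -1 * (s - b)| <= 2^-1 * `|s - b|.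
  by near: d.
have A3 : forall s, `|s - e| <= d ->
    `|al * (x s - x e) + bt * (y s - y e) - 1 * (s - e)| <= 2^-1 * `|s - e|.
  by near: d.
split=> [s /andP[as_ sb]|t /andP[bt_ te]].
- have [->|sa] := eqVneq s a; first by constructor 1.
  have [->|sb'] := eqVneq s b; first by constructor 2.
  have {}as_ : a < s by rewrite lt_neqAle eq_sym sa.
  have {}sb : s < b by rewrite lt_neqAle sb'.
  move=> [sd|sd]; constructor 3.
  + have := A1 _ sd; rewrite (gtr0_norm (_ : 0 < s - a)) ?subr_gt0 //
      ler_norml => /andP[h _]; lra.
  + have := A2 _ sd; rewrite (ltr0_norm (_ : s - b < 0)) ?subr_lt0 //
      ler_norml xab yab => /andP[h _]; lra.
- have [->|sa] := eqVneq t b; first by constructor 1.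
  have [->|sb'] := eqVneq t e; first by constructor 2.
  have {}as_ : b < t by rewrite lt_neqAle eq_sym sa.
  have {}sb : t < e by rewrite lt_neqAle sb'.
  move=> [sd|sd]; constructor 3.
  + have := A2 _ sd; rewrite (gtr0_norm (_ : 0 < t - b)) ?subr_gt0 //
      ler_norml xab yab => /andP[_ h]; lra.
  + have := A3 _ sd; rewrite (ltr0_norm (_ : t - e < 0)) ?subr_lt0 //
      ler_norml xae yae => /andP[_ h]; lra.
Unshelve. all: by end_near. Qed.

(* The crossings between the two loops: [s z] is the passage of the first loop and
   [t z] that of the second one. *)
Variables (I : finType) (P : pred I) (s t : I -> R).
Hypothesis s_itv : forall z, P z -> a < s z < b.
Hypothesis t_itv : forall z, P z -> b < t z < e.
Hypothesis s_inj : forall z z', P z -> P z' -> s z = s z' -> z = z'.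
Hypothesis xst : forall z, P z -> x (s z) = x (t z).
Hypothesis yst : forall z, P z -> y (s z) = y (t z).
Hypothesis transversal : forall z, P z ->
  frame_det (velocity x y (s z)) (velocity x y (t z)) != 0.
Hypothesis double_points : forall s' t', a <= s' <= b -> b <= t' <= e ->
  x s' = x t' -> y s' = y t' ->
  (s' = a \/ s' = b) /\ (t' = b \/ t' = e) \/
  exists z, [/\ P z, s' = s z & t' = t z].

Let special : set (R * R) := [set q | (q.1 = a \/ q.1 = b) /\ (q.2 = b \/ q.2 = e) \/
  exists z, [/\ P z, q.1 = s z & q.2 = t z]].

Lemma bounded_away (d : R) : 0 < d -> exists2 m, 0 < m & forall p,
  a <= p.1 <= b -> b <= p.2 <= e ->
  (forall q, special q -> ~ ball q d p) -> m <= `|difference p|.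
Proof.
move=> d0.
pose C := (`[a, b] `*` `[b, e]) `&` ~` \bigcup_(q in special) ball q d.
have cf (f : R -> R) : (forall u : R, derivable f u 1) ->
    continuous (fun p : R * R => f p.1 - f p.2).
  move=> df p; have cont u : {for u, continuous f}.
    by apply: differentiable_continuous; apply/derivable1_diffP.
  by apply: cvgB; apply: continuous_comp (cont _); [exact: cvg_fst|exact: cvg_snd].
have cF : continuous difference by move=> p; exact: cvg_pair (cf x dx p) (cf y dy p).
have cC : compact C.
  have cab : compact (`[a, b] `*` `[b, e]) by apply: compact_setX; exact: segment_compact.
  apply: compact_closedI => //; apply: open_closedC.
  by apply: bigcup_open => q _; exact: ball_open.
have F0 p : C p -> difference p <> 0.
  move=> [[/= p1 p2] np] [/eqP]; rewrite subr_eq0 => /eqP ex.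
  move=> /eqP; rewrite subr_eq0 => /eqP ey.
  apply: np; exists p; last exact: ballxx.
  by apply: double_points => //; move: p1 p2; rewrite !in_itv.
have [m m0 hm] := compact_norm_bounded_away cC cF F0.
exists m => // p p1 p2 np; apply: hm; split; first by split; rewrite /= in_itv.
by move=> [q sq bq]; apply: np bq.
Qed.

Lemma corner_cell_turning K d al bt i j (q : R * R) :
  separated_at_corners al bt d -> 0 < al * derive1 x a + bt * derive1 y a ->
  (0 < K)%N -> (b - a) / K%:R <= d / 4 -> (e - b) / K%:R <= d / 4 ->
  (i < K)%N -> (j < K)%N -> q.1 = a \/ q.1 = b -> q.2 = b \/ q.2 = e ->
  ball q (d / 2) (grid a b K i, grid b e K j) ->
  cell_turning (grid_value (velocity x y a) K) i j = 0.
Proof.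
move=> [seps sept] albt K0 hs ht iK jK q1 q2 [/= bq1 bq2].
apply: (@cell_turning_half_plane _ al bt) => i' j' ii' jj'.
have sq := ball_step bq1 (grid_step (ltW ab) hs ii').
have tq := ball_step bq2 (grid_step (ltW b_e) ht jj').
have i'K : (i' <= K)%N by case/andP: ii' => _ /leq_trans; apply.
have j'K : (j' <= K)%N by case/andP: jj' => _ /leq_trans; apply.
have sI := grid_itv (ltW ab) K0 i'K; have tI := grid_itv (ltW b_e) K0 j'K.
have {sq sI} : [\/ grid a b K i' = a, grid a b K i' = b |
    al * x a + bt * y a < al * x (grid a b K i') + bt * y (grid a b K i')].
  by apply: seps sI _; case: q1 sq => ->; [left|right].
have {tq tI} : [\/ grid b e K j' = b, grid b e K j' = e |
    al * x (grid b e K j') + bt * y (grid b e K j') < al * x a + bt * y a].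
  by apply: sept tI _; case: q2 tq => ->; [left|right].
rewrite /grid_value; case: eqP => [//|]; rewrite /in_half_plane /difference /=.
set s' := grid a b K i'; set t' := grid b e K j' => nz tP sP.
have xya : (x t' = x a /\ y t' = y a) \/ al * x t' + bt * y t' < al * x a + bt * y a.
  by case: tP => [->|->|]; [left|left|right].
have xyb : (x s' = x a /\ y s' = y a) \/ al * x a + bt * y a < al * x s' + bt * y s'.
  by case: sP => [->|->|]; [left|left|right].
move: nz; case: xya => [[-> ->]|t'P]; case: xyb => [[-> ->]|s'P] nz.
- by case: nz; rewrite !subrr.
- by lra.
- by lra.
- by lra.
Qed.

Lemma far_cell_turning K v k h m i j :
  (forall f, f = x \/ f = y -> forall s t, a <= s <= e -> a <= t <= e ->
    `|f s - f t| <= k * `|s - t|) ->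
  0 < k -> 2 * k * h < m -> 0 < m ->
  (0 < K)%N -> (b - a) / K%:R <= h -> (e - b) / K%:R <= h ->
  (i < K)%N -> (j < K)%N ->
  m <= `|difference (grid a b K i, grid b e K j)| ->
  cell_turning (grid_value v K) i j = 0.
Proof.
move=> lip k0 kh m0 K0 hs ht iK jK far.
have osc f i' j' : f = x \/ f = y -> (i <= i' <= i.+1)%N -> (j <= j' <= j.+1)%N ->
    `|(f (grid a b K i') - f (grid b e K j')) - (f (grid a b K i) - f (grid b e K j))| < m.
  move=> fxy ii' jj'.
  have i'K : (i' <= K)%N by case/andP: ii' => _ /leq_trans; apply.
  have j'K : (j' <= K)%N by case/andP: jj' => _ /leq_trans; apply.
  have [sI tI] := (grid_itv (ltW ab) K0 i'K, grid_itv (ltW b_e) K0 j'K).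
  have [sI0 tI0] := (grid_itv (ltW ab) K0 (ltnW iK), grid_itv (ltW b_e) K0 (ltnW jK)).
  have [st tt'] := (grid_step (ltW ab) hs ii', grid_step (ltW b_e) ht jj').
  have wide1 u : a <= u <= b -> a <= u <= e.
    by case/andP=> -> /= /le_trans; apply; exact: ltW.
  have wide2 u : b <= u <= e -> a <= u <= e.
    by case/andP=> h1 ->; rewrite andbT (le_trans (ltW ab)).
  have l1 := lip f fxy _ _ (wide1 _ sI) (wide1 _ sI0).
  have l2 := lip f fxy _ _ (wide2 _ tI) (wide2 _ tI0).
  by apply: le_lt_trans kh; exact: lipschitz_difference_osc.
have [al [bt half]] := half_plane_of_square m0 far.
apply: (@cell_turning_half_plane _ al bt) => i' j' ii' jj'.
apply: grid_value_half_plane.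
by apply: (half (difference (grid a b K i', grid b e K j'))); apply: osc => //; [left|right].
Qed.

(** On a fine grid the total turning is 0, and it is concentrated in the blocks
    around the crossings, each of which contributes the opposite of its sign. *)
Theorem sum_mutual_crossings :
  \sum_(z | P z) (if 0 < frame_det (velocity x y (s z)) (velocity x y (t z))
                  then 1 else -1) = 0 :> int.
Proof.
have [al [bt [albt cor]]] := near_corner.
(* The scale d at which the local descriptions hold around every zero, and at
   which the blocks are disjoint. *)
have loc : \forall d \near 0^'+, forall z, P z -> linear_at_crossing (s z) (t z) d.
  apply: filter_forall => z; case: (boolP (P z)) => Pz; last by near=> d.
  near=> d => _; near: d.
  by apply: near_linear_at_crossing; [exact: transversal|exact: xst|exact: yst].
have inside : \forall d \near 0^'+, forall z, P z ->
    [/\ a <= s z - d, s z + d <= b, b <= t z - d & t z + d <= e].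
  apply: filter_forall => z; case: (boolP (P z)) => Pz; last by near=> d.
  have /andP[s1 s2] := s_itv Pz; have /andP[t1 t2] := t_itv Pz.
  near=> d => _.
  have d1 : d < s z - a by near: d; apply: nbhs_right_lt; rewrite subr_gt0.
  have d2 : d < b - s z by near: d; apply: nbhs_right_lt; rewrite subr_gt0.
  have d3 : d < t z - b by near: d; apply: nbhs_right_lt; rewrite subr_gt0.
  have d4 : d < e - t z by near: d; apply: nbhs_right_lt; rewrite subr_gt0.
  by split; lra.
have apart : \forall d \near 0^'+, forall z z', P z -> P z' -> `|s z - s z'| <= d -> z = z'.
  apply: filter_forall => z; apply: filter_forall => z'.
  have [->|zz'] := eqVneq z z'; first by near=> d.
  have [szz'|szz'] := eqVneq (s z) (s z').
    by near=> d => Pz Pz'; have := s_inj Pz Pz' szz'.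
  near=> d => Pz Pz'; rewrite leNgt => /negP[]; near: d; apply: nbhs_right_lt.
  by rewrite normr_gt0 subr_eq0.
have apart2 : \forall d \near 0^'+, forall z z', P z -> P z' ->
    `|s z - s z'| <= 2 * d -> z = z'.
  case: apart => r /= r0 hr; exists (r / 2); first by rewrite /= divr_gt0.
  move=> d /=; rewrite sub0r normrN => dr d0; apply: hr; rewrite /= ?mulr_gt0 //.
  by rewrite sub0r normrN normrM ger0_norm // mulrC -ltr_pdivlMr.
have pos : \forall d \near (0 : R)^'+, 0 < d by exact: nbhs_right_gt.
have [d [[[[d0 dsep] dloc] din] dap]] := filter_ex
  (filterI (filterI (filterI (filterI pos cor) loc) inside) apart2).
have [m m0 hm] := bounded_away (divr_gt0 d0 (ltr0Sn R 1)).
have ae : a <= e by apply: ltW; apply: lt_trans b_e.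
have [k k0 lip] : exists2 k, 0 < k & forall f, f = x \/ f = y ->
    forall s t, a <= s <= e -> a <= t <= e -> `|f s - f t| <= k * `|s - t|.
  have [kx kx0 lipx] := lipschitz_segment ae dx cdx.
  have [ky ky0 lipy] := lipschitz_segment ae dy cdy.
  exists (kx + ky); first exact: addr_gt0.
  move=> f [->|->] s' t' s'P t'P; rewrite mulrDl.
    by apply: le_trans (lipx _ _ s'P t'P) _; rewrite lerDl mulr_ge0 // ltW.
  by apply: le_trans (lipy _ _ s'P t'P) _; rewrite lerDr mulr_ge0 // ltW.
(* The mesh must be small both with respect to the blocks and with respect to the
   oscillation that keeps a vector of norm at least m away from 0. *)
have [K K0 [hd hm']] : exists2 K : nat, (0 < K)%N &
    (e - a) / K%:R <= d / 4 /\ 2 * k * ((e - a) / K%:R) < m.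
  have ea0 : 0 < e - a by rewrite subr_gt0; apply: lt_trans b_e.
  have X1 : 0 < (e - a) / (d / 4) by rewrite !divr_gt0.
  have X2 : 0 < 2 * k * (e - a) / m by rewrite divr_gt0 // !mulr_gt0.
  have := archi_boundP (ltW (addr_gt0 X1 X2)); set K := Num.bound _ => XK.
  have K0 : 0 < K%:R :> R by apply: le_lt_trans XK; rewrite ltW // addr_gt0.
  exists K; first by rewrite -(ltr0n R).
  split.
    rewrite ler_pdivrMr // -ler_pdivrMl ?divr_gt0 // mulrC.
    by apply: ltW; apply: le_lt_trans XK; rewrite lerDl ltW.
  rewrite mulrA ltr_pdivrMr // -ltr_pdivrMl // mulrC.
  by apply: le_lt_trans XK; rewrite lerDr ltW.
have hs : (b - a) / K%:R <= (e - a) / K%:R.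
  by rewrite ler_pM2r ?invr_gt0 ?ltr0n // lerD2r ltW.
have ht : (e - b) / K%:R <= (e - a) / K%:R.
  by rewrite ler_pM2r ?invr_gt0 ?ltr0n // lerD2l lerN2 ltW.
have hsd := le_trans hs hd; have htd := le_trans ht hd.
have range z : exists r : nat * nat * (nat * nat), P z -> [/\
    [/\ (r.1.1 <= r.1.2 <= K)%N,
      grid a b K r.1.1 <= s z - d * 3 / 4, s z + d * 3 / 4 <= grid a b K r.1.2,
      forall i, (r.1.1 <= i <= r.1.2)%N -> `|grid a b K i - s z| <= d &
      forall i, `|grid a b K i - s z| < d / 2 -> (r.1.1 <= i < r.1.2)%N] &
    [/\ (r.2.1 <= r.2.2 <= K)%N,
      grid b e K r.2.1 <= t z - d * 3 / 4, t z + d * 3 / 4 <= grid b e K r.2.2,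
      forall j, (r.2.1 <= j <= r.2.2)%N -> `|grid b e K j - t z| <= d &
      forall j, `|grid b e K j - t z| < d / 2 -> (r.2.1 <= j < r.2.2)%N]].
  case: (boolP (P z)) => Pz; last by exists (0%N, 0%N, (0%N, 0%N)).
  have [z1 z2 z3 z4] := din z Pz.
  have [i0 [i1 iP]] := grid_window (ltW ab) K0 d0 hsd z1 z2.
  have [j0 [j1 jP]] := grid_window (ltW b_e) K0 d0 htd z3 z4.
  by exists (i0, i1, (j0, j1)).
have [r rP] := choice range.
pose i0 z := (r z).1.1; pose i1 z := (r z).1.2.
pose j0 z := (r z).2.1; pose j1 z := (r z).2.2.
pose G := grid_value (velocity x y a) K.
have blockE z : P z ->
    \sum_(i0 z <= i < i1 z) \sum_(j0 z <= j < j1 z) cell_turning G i j =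
    if 0 < frame_det (velocity x y (s z)) (velocity x y (t z)) then -1 else 1.
  move=> Pz; have [[/andP[? _] ? ? ? _] [/andP[? _] ? ? ? _]] := rP z Pz.
  by apply: (crossing_block_turning _ d0) => //; exact: dloc.
have GK i : G i K = G i 0%N.
  by rewrite /G /grid_value /difference /= gridK // grid0 xae yae xab yab.
have KG j : G K j = G 0%N j.
  by rewrite /G /grid_value /difference /= gridK // grid0 xab yab.
have ubound z : P z -> (i1 z <= K)%N /\ (j1 z <= K)%N.
  by move=> Pz; have [[/andP[_ ?] _ _ _ _] [/andP[_ ?] _ _ _ _]] := rP z Pz.
have disjoint z z' i : P z -> P z' -> (i0 z <= i < i1 z)%N ->
    (i0 z' <= i < i1 z')%N -> z = z'.
  move=> Pz Pz' /andP[iz zi] /andP[iz' zi']; apply: (dap z z' Pz Pz').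
  have [[_ _ _ near_z _] _] := rP z Pz; have [[_ _ _ near_z' _] _] := rP z' Pz'.
  have hz : `|grid a b K i - s z| <= d by apply: near_z; rewrite iz ltnW.
  have hz' : `|grid a b K i - s z'| <= d by apply: near_z'; rewrite iz' ltnW.
  have -> : s z - s z' = (grid a b K i - s z') - (grid a b K i - s z) by ring.
  apply: le_trans (ler_normB _ _) _; rewrite mulr_natl mulr2n; exact: lerD.
suff cover i j : (i < K)%N -> (j < K)%N -> cell_turning G i j <> 0 ->
    exists z, [/\ P z, (i0 z <= i < i1 z)%N & (j0 z <= j < j1 z)%N].
  have := sum_block_turning GK KG ubound cover disjoint.
  rewrite (eq_bigr _ blockE) => tot.
  apply/eqP; rewrite -oppr_eq0 -sumrN; apply/eqP; apply: etrans tot.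
  by apply: eq_bigr => z _; case: ifP => _; rewrite ?opprK.
move=> iK jK cell0.
(* The base point of the cell is close to a corner, close to a crossing, or far
   from all zeros. *)
have [[q [spq bq]]|nq] :=
    pselect (exists q, special q /\ ball q (d / 2) (grid a b K i, grid b e K j)).
  case: spq => [[q1 q2]|[z [Pz q1 q2]]].
    by case: cell0; exact: (corner_cell_turning dsep albt K0 hsd htd iK jK q1 q2 bq).
  case: bq; rewrite /ball /= q1 q2 distrC (distrC (t z)) => bq1 bq2.
  exists z; split=> //.
  - by have [[_ _ _ _ near_z] _] := rP z Pz; exact: near_z.
  - by have [_ [_ _ _ _ near_z]] := rP z Pz; exact: near_z.
case: cell0; apply: (far_cell_turning _ lip k0 hm') => //.
apply: hm => [||q sq bq].
- exact: grid_itv (ltW ab) K0 (ltnW iK).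
- exact: grid_itv (ltW b_e) K0 (ltnW jK).
- by apply: nq; exists q.
Unshelve. all: by end_near. Qed.
End TwoLoops.

(** * Arcs of the circle as intervals *)

Section Lift.
Variable R : realType.
Implicit Types u p q : R.

(** Cutting the circle at [u] identifies it with [[u, u + 1[]. *)
Definition lift_param u p : R := if u <= p then p else p + 1.

Lemma lift_param_itv u p : 0 <= u < 1 -> 0 <= p < 1 -> u <= lift_param u p < u + 1.
Proof.
rewrite /lift_param => /andP[u0 u1] /andP[p0 p1].
by case: (leP u p) => up; apply/andP; split; lra.
Qed.

Lemma lift_param_inj u p q : 0 <= p < 1 -> 0 <= q < 1 ->
  lift_param u p = lift_param u q -> p = q.
Proof.
by rewrite /lift_param => /andP[? ?] /andP[? ?];
  case: (leP u p) => ?; case: (leP u q) => ? ?; lra.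
Qed.

Lemma lift_param_surj u p : 0 <= u < 1 -> u <= p < u + 1 ->
  exists2 q, 0 <= q < 1 & p = lift_param u q.
Proof.
move=> /andP[u0 u1] /andP[up pu]; have [p1|p1] := ltP p 1.
  by exists p; rewrite /lift_param ?up // p1 andbT; lra.
exists (p - 1); first by apply/andP; split; lra.
by rewrite /lift_param ifF ?subrK //; apply/negbTE; rewrite -ltNge; lra.
Qed.

Lemma on_arc_lift u o p : 0 <= u < 1 -> 0 <= o < 1 -> 0 <= p < 1 -> u != o ->
  on_arc u o p = (lift_param u p < lift_param u o).
Proof.
move=> /andP[u0 u1] /andP[v0 v1] /andP[p0 p1].
rewrite /on_arc /lift_param; case: (ltgtP u o) => // uo _.
- case: (leP u p) => [//|up].
  by apply/esym/negbTE; rewrite -leNgt; lra.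
- case: (leP u p) => up; last by rewrite ltrD2r.
  by apply/esym; lra.
Qed.
End Lift.

(** * Passage signs of a virtual knot diagram *)

Section Diagram.
Variables (R : realType) (D : vdiagram R).

Notation crossing := (classical D + virtual D)%type.

Definition passage_sign (p : crossing * bool) : int :=
  if other_right_to_left p.1 p.2 then 1 else -1.

Definition flip {T : Type} (p : T * bool) : T * bool := (p.1, ~~ p.2).

Lemma flipK T : involutive (@flip T).
Proof. by case=> c k; rewrite /flip negbK. Qed.

Lemma frame_detC (u v : R * R) : frame_det v u = - frame_det u v.
Proof. by rewrite /frame_det; ring. Qed.

Lemma passage_transversal (c : crossing) k :
  frame_det (direction c k) (direction c (~~ k)) != 0.
Proof.
by case: k => /=; rewrite ?[frame_det _ (direction c true)]frame_detC ?oppr_eq0;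
  exact: vd_transversal.
Qed.

Lemma passage_sign_flip p : passage_sign (flip p) = - passage_sign p.
Proof.
rewrite /passage_sign /other_right_to_left /= negbK frame_detC oppr_gt0.
by case: ltgtP (passage_transversal p.1 p.2) => //; rewrite opprK.
Qed.

Lemma sum_flip0 (T : finType) (f : T * bool -> int) (Q : pred (T * bool)) :
  (forall p, f (flip p) = - f p) -> (forall p, Q (flip p) = Q p) ->
  \sum_(p | Q p) f p = 0.
Proof.
move=> fN QE; have selfN (n : int) : n = - n -> n = 0 by lia.
apply: selfN; rewrite {1}(reindex_inj (inv_inj (@flipK T))) /= -sumrN.
by apply: eq_big => [p|p _]; [exact: QE|exact: fN].
Qed.

Lemma derive1_periodic (f : R -> R) : (forall t, f (t + 1) = f t) ->
  forall t, derive1 f (t + 1) = derive1 f t.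
Proof.
move=> fp t; rewrite /derive1 fp.
by under eq_fun do rewrite addrA fp.
Qed.

Lemma velocity_lift u p :
  velocity (xcoord D) (ycoord D) (lift_param u p) = velocity (xcoord D) (ycoord D) p.
Proof.
rewrite /lift_param; case: ifP => // _; have [per _ _ _] := vd_immersion D.
by congr (_, _); apply: derive1_periodic => t; have [] := per t.
Qed.

Lemma coord_lift u p : xcoord D (lift_param u p) = xcoord D p /\
  ycoord D (lift_param u p) = ycoord D p.
Proof.
by rewrite /lift_param; case: ifP => // _; have [per _ _ _] := vd_immersion D; exact: per.
Qed.

Lemma pass_double_flip (c : crossing) k :
  xcoord D (pass c k) = xcoord D (pass c (~~ k)) /\
  ycoord D (pass c k) = ycoord D (pass c (~~ k)).
Proof. by have [hx hy] := pass_double c; case: k => /=; rewrite hx hy. Qed.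

(** The crossings passed twice by the half of the diagram contribute 0, and the
    remaining passages are the crossings between the two halves, to which
    [sum_mutual_crossings] applies after cutting the circle at [pass c false]. *)
Lemma sum_signs_half (c : crossing) :
  \sum_(p : crossing * bool | (p.1 != c) &&
      on_arc (pass c false) (pass c true) (pass p.1 p.2)) passage_sign p = 0.
Proof.
set u := pass c false; set o := pass c true.
have [ci_per ci_der [cdx cdy] _] := vd_immersion D.
have uP : 0 <= u < 1 by exact: pass_range.
have oP : 0 <= o < 1 by exact: pass_range.
have uo : u != o by apply/eqP => /pass_inj[].
pose L (p : crossing * bool) := lift_param u (pass p.1 p.2).
pose b := lift_param u o.
have lift_u : lift_param u u = u by rewrite /lift_param lexx.
have LI p : u <= L p < u + 1 by apply: lift_param_itv => //; exact: pass_range.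
have L_inj p q : L p = L q -> p = q.
  case: p q => [d k] [d' k'] /lift_param_inj /= h.
  by have [-> ->] := pass_inj (h (pass_range _ _) (pass_range _ _)).
have LE p : on_arc u o (pass p.1 p.2) = (L p < b).
  by rewrite on_arc_lift // pass_range.
have Lu p : p.1 != c -> L p != u.
  apply: contraNneq => h; rewrite -lift_u in h.
  by rewrite (L_inj p (c, false) h).
have Lb p : p.1 != c -> L p != b.
  by apply: contraNneq => h; rewrite (L_inj p (c, true) h).
(* The first sum runs over the crossings passed twice. *)
rewrite (bigID (fun p => L (flip p) < b)) /=.
rewrite (sum_flip0 passage_sign_flip) ?add0r; last first.
  by move=> p; rewrite !LE flipK /= -!andbA; congr (_ && _); rewrite andbC.
pose P p := [&& p.1 != c, L p < b & b <= L (flip p)].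
transitivity (\sum_(p | P p) passage_sign p).
  by apply: eq_bigl => p; rewrite /P LE -leNgt andbA.
have ub : u < b.
  have /andP[h _] := LI (c, true).
  rewrite lt_neqAle h andbT; apply: contra uo => /eqP h'.
  by apply/eqP/(lift_param_inj (u := u)) => //; rewrite lift_u.
have bu1 : b < u + 1 by have /andP[] := LI (c, true).
have [xbo ybo] := coord_lift u o.
have [xuo yuo] := pass_double_flip c true; rewrite /= in xuo yuo.
have velP p : velocity (xcoord D) (ycoord D) (L p) = direction p.1 p.2.
  exact: velocity_lift.
have hb p : P p -> u < L p < b.
  case/and3P=> pc Lpb _; rewrite Lpb andbT lt_neqAle eq_sym Lu //.
  by have /andP[] := LI p.
have he p : P p -> b < L (flip p) < u + 1.
  case/and3P=> pc _ bL; rewrite lt_neqAle eq_sym Lb // bL.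
  by have /andP[] := LI (flip p).
have hx p : P p -> xcoord D (L p) = xcoord D (L (flip p)).
  move=> _; rewrite (coord_lift u _).1 (coord_lift u (pass (flip p).1 _)).1.
  exact: (pass_double_flip _ _).1.
have hy p : P p -> ycoord D (L p) = ycoord D (L (flip p)).
  move=> _; rewrite (coord_lift u _).2 (coord_lift u (pass (flip p).1 _)).2.
  exact: (pass_double_flip _ _).2.
have hdet p : P p -> frame_det (velocity (xcoord D) (ycoord D) (L p))
    (velocity (xcoord D) (ycoord D) (L (flip p))) != 0.
  by move=> _; rewrite !velP; exact: passage_transversal.
have corner : frame_det (velocity (xcoord D) (ycoord D) u)
    (velocity (xcoord D) (ycoord D) b) != 0.
  by rewrite /b velocity_lift; exact: (passage_transversal c false).
have inj p q : P p -> P q -> L p = L q -> p = q by move=> _ _; exact: L_inj.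
have vel_e : velocity (xcoord D) (ycoord D) (u + 1) = velocity (xcoord D) (ycoord D) u.
  by congr (_, _); apply: derive1_periodic => t; have [] := ci_per t.
rewrite (eq_bigr (fun p => if 0 < frame_det (velocity (xcoord D) (ycoord D) (L p))
    (velocity (xcoord D) (ycoord D) (L (flip p))) then 1 else -1)); last first.
  by move=> p _; rewrite !velP.
apply: (sum_mutual_crossings _ _ ub bu1 cdx cdy _ _ _ _ vel_e corner hb he inj hx hy hdet).
- by move=> t; have [] := ci_der t.
- by move=> t; have [] := ci_der t.
- by rewrite xbo.
- by rewrite ybo.
- by have [] := ci_per u.
- by have [] := ci_per u.
move=> s t /andP[us sb] /andP[bt te] xst yst.
have sP : u <= s < u + 1 by rewrite us (le_lt_trans sb bu1).
(* The end point u + 1 of the second loop is the point u of the circle. *)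
have [t' [t'P [xt' yt'] tE]] : exists t', [/\ u <= t' < u + 1,
    xcoord D t' = xcoord D t /\ ycoord D t' = ycoord D t &
    (t = u + 1 /\ t' = u) \/ t = t'].
  have [tu|tu] := eqVneq t (u + 1).
    exists u; split; [by rewrite lexx ltrDl ltr01| |by left].
    by rewrite tu; have [-> ->] := ci_per u.
  exists t; split; [|by []|by right].
  by rewrite (le_trans (ltW ub) bt) lt_neqAle tu.
have [q qP sq] := lift_param_surj uP sP.
have [q' q'P tq'] := lift_param_surj uP t'P.
have [xs ys] := coord_lift u q; have [xt yt] := coord_lift u q'.
have [qq'|qq'] := eqVneq q q'.
  left; have st : s = t' by rewrite sq tq' qq'.
  case: tE => [[-> tu]|tt']; first by rewrite st tu; split; [left|right].
  have -> : t = b by apply/le_anti; rewrite bt andbT tt' -st.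
  by split; [right; apply/le_anti; rewrite sb st -tt'|left].
have xqq' : xcoord D q = xcoord D q' by rewrite -xs -xt -sq -tq' xt'.
have yqq' : ycoord D q = ycoord D q' by rewrite -ys -yt -sq -tq' yt'.
have [d [k [qd q'd]]] := vd_double_points qP q'P (elimN eqP qq') xqq' yqq'.
have sL : s = L (d, k) by rewrite sq qd.
have tL : t' = L (flip (d, k)) by rewrite tq' q'd.
have [dc|dc] := eqVneq d c.
  left; have side k' : L (d, k') = u \/ L (d, k') = b.
    by rewrite /L dc; case: k'; [right|left].
  split; first by rewrite sL; exact: side.
  case: tE => [[-> _]|tt']; first by right.
  left; have := side (~~ k); rewrite -[L _]tL -tt' => -[tu|//].
  by move: bt; rewrite tu leNgt ub.
right; exists (d, k); split=> //.
  apply/and3P; split=> //; first by rewrite lt_neqAle Lb // -sL.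
  case: tE => [[_ t'u]|tt']; last by rewrite -tL -tt'.
  by have := Lu (flip (d, k)) dc; rewrite -tL t'u eqxx.
case: tE => [[_ t'u]|->]; last by [].
by have := Lu (flip (d, k)) dc; rewrite -tL t'u eqxx.
Qed.

(** * Sign counts and the core cycle *)

Definition sign_count (f : R -> bool) : int :=
  \sum_(p : virtual D * bool | f (pass (inr p.1) p.2)) passage_sign (inr p.1, p.2).

Lemma sign_count_all : sign_count xpredT = 0.
Proof.
apply: (@sum_flip0 _ (fun p => passage_sign (inr p.1, p.2))) => // -[d k].
exact: (passage_sign_flip (inr d, k)).
Qed.

(** For an arc that contains the base point of the circle, the two sides differ by
    the count over the whole circle, which is 0. *)
Lemma sign_count_arc s t :
  sign_count (on_arc s t) = sign_count (< t) - sign_count (< s).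
Proof.
have step : sign_count (on_arc s t) =
    sign_count (< t) - sign_count (< s) + (if s < t then 0 else sign_count xpredT).
  rewrite /sign_count !(big_mkcond (fun p => _ (pass _ _))) /= -sumrB.
  case: ltP => st; rewrite ?addr0 -?big_split /=.
  - apply: eq_bigr => p _; rewrite /on_arc st.
    set q := pass _ _; case: (ltP q s) => qs /=.
      by rewrite (lt_trans qs st) subrr.
    by rewrite subr0.
  - apply: eq_bigr => p _; rewrite /on_arc ltNge st /=.
    set q := pass _ _; case: (ltP q s) => qs /=; last first.
      rewrite subr0; case: ltP => qt; rewrite ?add0r //.
      by have := lt_le_trans qt st; rewrite ltNge qs.
    by rewrite subrK.
by rewrite step sign_count_all if_same addr0.
Qed.

(** The half [D^+_c] is the arc from the undercrossing to the overcrossing for both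
    signs of [c].  The classical passages of this arc are counted in the index with
    the opposite of their sign, and they balance the virtual ones. *)
Lemma crossing_indexE (c : classical D) : crossing_index D c =
  sign_count (on_arc (pass (inl c : crossing) false) (pass (inl c : crossing) true)).
Proof.
have posE p : on_positive_half c p =
    on_arc (pass (inl c : crossing) false) (pass (inl c : crossing) true) p.
  rewrite /on_positive_half /on_left_half /on_right_half /crossing_sign /strand_b /strand_a.
  by case: (0 < frame_det _ _).
apply/eqP; rewrite -subr_eq0 -oppr_eq0 opprB; apply/eqP.
apply: etrans (sum_signs_half (inl c)).
rewrite [RHS]big_mkcond -(pair_bigA _ (fun d k => if (d != inl c) &&
  on_arc (pass (inl c : crossing) false) (pass (inl c : crossing) true) (pass d k)
  then passage_sign (d, k) else 0)) /= big_sumType /= !pair_bigA /= addrC.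
rewrite /sign_count /crossing_index; congr (_ + _); first by rewrite big_mkcond.
rewrite -sumrN big_mkcond /=; apply: eq_bigr => -[d k] _ /=.
rewrite posE; case: ifP => // _.
rewrite /passage_sign /other_left_to_right /other_right_to_left /=.
by case: ltgtP (passage_transversal (inl d) k) => //; rewrite ?opprK.
Qed.

Lemma vertex_param_itv (v : gauss_vertex D) : 0 <= vertex_param v < 1.
Proof.
by case: v => [[c k]|i] /=; [exact: pass_range|rewrite lexx ltr01].
Qed.

Lemma vertex_param_inj : injective (@vertex_param R D).
Proof.
have no_basepoint (c : classical D) (i : 'I_(#|classical D| == 0%N)) : False.
  by case: i => i; rewrite (cardD1 c).
move=> [[c k]|i] [[c' k']|i'] /=.
- by move=> /pass_inj[[->] ->].
- by case: (no_basepoint c i').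
- by case: (no_basepoint c' i).
- move=> _; congr inr; apply: val_inj => /=.
  case: i i' => i + [i' +] /=; case: (_ == _) => //.
  by rewrite !ltnS !leqn0 => /eqP -> /eqP ->.
Qed.

Lemma arc_length_next (p n q : R) : 0 <= p < 1 -> 0 <= n < 1 -> 0 <= q < 1 ->
  p != q -> n != q -> arc_length p n <= arc_length p q ->
  arc_length n q < arc_length p q.
Proof.
move=> /andP[? ?] /andP[? ?] /andP[? ?] pq nq; rewrite /arc_length.
by case: (ltgtP p n) => ?; case: (ltgtP p q) pq => // ? _;
  case: (ltgtP n q) nq => // ? _ ?; lra.
Qed.

(** The core cycle is connected: among the vertices [u] with [g u != g w] take the
    one from which [w] is reached first; the next vertex of [u] is even closer to
    [w]. *)
Lemma next_vertex_constant (g : gauss_vertex D -> int) :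
  (forall v, g (next_vertex v) = g v) -> forall v w, g v = g w.
Proof.
move=> gnext v w; apply/eqP; apply/negP => /negP gvw.
have [u gu umin] : exists2 u, g u != g w & forall u', g u' != g w ->
    arc_length (vertex_param u) (vertex_param w) <=
    arc_length (vertex_param u') (vertex_param w).
  case: (arg_minP (P := fun u => g u != g w)
    (fun u => arc_length (vertex_param u) (vertex_param w)) gvw) => u gu umin.
  by exists u.
have next_min : arc_length (vertex_param u) (vertex_param (next_vertex u)) <=
    arc_length (vertex_param u) (vertex_param w).
  by rewrite /next_vertex; case: arg_minP => // n _; apply.
have := umin (next_vertex u); rewrite gnext => /(_ gu); rewrite leNgt => /negP[].
apply: arc_length_next => //; try exact: vertex_param_itv.
- by apply: contraNneq gu => /vertex_param_inj ->.
- by apply: contraNneq gu => /vertex_param_inj <-; rewrite gnext.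
Qed.

End Diagram.

Theorem proposition5 (R : realType) (D : vdiagram R) :
  (exists! i : cochain1 (gauss_diagram D),
     cohomology_class i = virtual_index_class D /\
     (forall v : gauss_vertex D, i (core_edge v) = 0)) /\
  (forall i : cochain1 (gauss_diagram D),
     cohomology_class i = virtual_index_class D ->
     (forall v : gauss_vertex D, i (core_edge v) = 0) ->
     forall c : classical D, i (chord c) = crossing_index D c).
Proof.
have virtual_core v : virtual_index_cocycle D (core_edge v) =
    sign_count D (< vertex_param (next_vertex v)) - sign_count D (< vertex_param v).
  by rewrite ffunE -sign_count_arc.
have value (i : cochain1 (gauss_diagram D)) :
    cohomology_class i = virtual_index_class D -> (forall v, i (core_edge v) = 0) ->
    forall c : classical D, i (chord c) = crossing_index D c.
  move=> icl icore c.
  have [g ig] : virtual_index_class D i.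
    by rewrite -icl; exists [ffun=> 0]; apply/ffunP => e; rewrite !ffunE subrr addr0.
  (* On the core edges the virtual index cocycle is the coboundary of the sign
     count, so that adding this count to g gives an invariant function. *)
  pose h v := g v + sign_count D (< vertex_param v).
  have hnext v : h (next_vertex v) = h v.
    have := icore v; rewrite ig ffunE virtual_core ffunE /= /h => e.
    by apply: subr0_eq; rewrite -[RHS]e; ring.
  have := next_vertex_constant hnext (inl (c, true)) (inl (c, false)).
  rewrite crossing_indexE sign_count_arc ig !ffunE /= /h => /eqP.
  rewrite -subr_eq0 => /eqP e; apply: subr0_eq; rewrite -[RHS]oppr0 -[in RHS]e; ring.
split; last exact: value.
pose g0 : {ffun vertex (gauss_diagram D) -> int} :=
  [ffun v => - sign_count D (< vertex_param v)].
pose i0 : cochain1 (gauss_diagram D) := virtual_index_cocycle D + coboundary g0.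
have i0_class : cohomology_class i0 = virtual_index_class D.
  apply/seteqP; split=> f [g ->].
    exists (g0 + g); apply/ffunP => e; rewrite !ffunE; ring.
  exists (g - g0); apply/ffunP => e; rewrite !ffunE; ring.
have i0_core v : i0 (core_edge v) = 0.
  by rewrite ffunE virtual_core !ffunE /=; ring.
exists i0; split=> // i [icl icore]; apply/ffunP => -[v|c].
  by rewrite [LHS]i0_core [RHS]icore.
by rewrite [LHS](value _ i0_class i0_core) [RHS](value _ icl icore).
Qed.
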